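(* Let $A$ carry an IF-structure in a strict symmetric monoidal $\dagger$-category, with groups $G_K$ of green phases and $H_K$ of red phases satisfying the IFK equations, such that $A$ has enough green-set-like elements with respect to $H_K$, and let $d$ be the exponent of $H_K$. Let $n\in\mathbb{N}$ and let $\mathbf{n}$ be the corresponding internal integer. The following are equivalent: (1) $d$ and $n$ are coprime; (2) $\delta_r\circ\mathbf{n}=(\mathbf{n}\otimes\mathbf{n})\circ\delta_r$ and $\epsilon_r\circ\mathbf{n}=\epsilon_r$; (3) $\mathbf{n}\circ\mu_g=\mu_g\circ(\mathbf{n}\otimes\mathbf{n})$ and $\mathbf{n}\circ\eta_g=\eta_g$.
   Context: Work in a strict symmetric monoidal $\dagger$-category (unit $I$, symmetry $\sigma$). A $\dagger$-SCFA on $A$ is $(\mu,\eta,\delta=\mu^\dagger,\epsilon=\eta^\dagger)$ with $(\mu,\eta)$ a commutative monoid, $(\mu\otimes\mathrm{id})(\mathrm{id}\otimes\delta)=\delta\mu=(\mathrm{id}\otimes\mu)(\delta\otimes\mathrm{id})$, and $\mu\delta=\mathrm{id}_A$. An IF-structure on $A$ is a pair of $\dagger$-SCFAs, green $(\mu_g,\eta_g,\delta_g,\epsilon_g)$ and red $(\mu_r,\eta_r,\delta_r,\epsilon_r)$, with $\delta_g\mu_r=(\mu_r\otimes\mu_r)(\mathrm{id}\otimes\sigma\otimes\mathrm{id})(\delta_g\otimes\delta_g)$, $\delta_g\eta_r=\eta_r\otimes\eta_r$, $\epsilon_g\mu_r=\epsilon_g\otimes\epsilon_g$, $\eta_r=(\epsilon_r\otimes\mathrm{id}_A)\delta_g\eta_g$,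 $\epsilon_g=\epsilon_r\mu_r(\mathrm{id}_A\otimes\eta_g)$; scalar factors built from $\epsilon_g\eta_r$ accompanying the bialgebra laws are suppressed throughout. A $c$-phase ($c\in\{g,r\}$) is a unitary $\alpha:A\to A$ with $\mu_c(\alpha\otimes\mathrm{id}_A)=\alpha\mu_c$; $\psi:I\to A$ is $c$-set-like if $\delta_c\psi=\psi\otimes\psi$. IFK equations: $G_K$ is a group of green phases with $g\eta_g$ red-set-like for all $g\in G_K$; $H_K$ is a group of red phases with $h\eta_r$ green-set-like for all $h\in H_K$. Enough green-set-like elements: for all $f,f':A\to B$, if $fh\eta_r=f'h\eta_r$ for all $h\in H_K$ then $f=f'$. Here $H_K$ is finite with exponent $d$ (least positive $d$ with $x^d=e$ for all $x\in H_K$). Internal integers: $\mathbf{0}:=\eta_r\epsilon_g$, $\mathbf{n+1}:=\mu_r(\mathbf{n}\otimes\mathrm{id}_A)\delta_g$. *)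

(* Defs.v *)
From Stdlib Require Import ProofIrrelevance.
From mathcomp Require Import all_boot.

Set Implicit Arguments.
Unset Strict Implicit.
Unset Printing Implicit Defensive.

Declare Scope smc_scope.
Delimit Scope smc_scope with smc.
Open Scope smc_scope.

Reserved Notation "g ∘ f" (at level 45, right associativity).
Reserved Notation "f ⊗ g" (at level 40, left associativity).
Reserved Notation "A ⊠ B" (at level 40, left associativity).
Reserved Notation "f ^†" (at level 1, format "f ^†").
Reserved Notation "s •^ k f" (at level 44, k at level 9, f at level 44,
  format "s  •^ k  f").
Reserved Notation "s • f" (at level 44, f at level 44).

Record category := Category {
  ob :> Type;
  hom : ob -> ob -> Type;
  idm : forall A, hom A A;
  comp : forall A B D, hom B D -> hom A B -> hom A D;
  compA : forall A B D E (h : hom D E) (g : hom B D) (f : hom A B),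
    comp h (comp g f) = comp (comp h g) f;
  comp_idl : forall A B (f : hom A B), comp (idm B) f = f;
  comp_idr : forall A B (f : hom A B), comp f (idm A) = f
}.

Arguments hom {c} A B.
Arguments idm {c} A.
Arguments comp {c A B D} g f.
Notation "g ∘ f" := (comp g f) : smc_scope.

(* An equality of objects, seen as the identity morphism between them.  In a *)
(* strict monoidal category the associator and the unitors are of this form. *)
Definition eqhom (C : category) (A B : C) (e : A = B) : hom A B :=
  match e in _ = B' return hom A B' with erefl => idm A end.

Record strict_monoidal := StrictMonoidal {
  sm_cat :> category;
  I1 : sm_cat;
  tens : sm_cat -> sm_cat -> sm_cat;
  tensm : forall A B A' B' : sm_cat,
    hom A B -> hom A' B' -> hom (tens A A') (tens B B');
  tensm_id : forall A B : sm_cat, tensm (idm A) (idm B) = idm (tens A B);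
  tensm_comp : forall (A B D A' B' D' : sm_cat) (g : hom B D) (f : hom A B)
      (g' : hom B' D') (f' : hom A' B'),
    tensm (g ∘ f) (g' ∘ f') = tensm g g' ∘ tensm f f';
  tensA : forall A B D : sm_cat, tens A (tens B D) = tens (tens A B) D;
  tens1l : forall A : sm_cat, tens I1 A = A;
  tens1r : forall A : sm_cat, tens A I1 = A;
  tensmA : forall (A B D A' B' D' : sm_cat)
      (f : hom A A') (g : hom B B') (h : hom D D'),
    eqhom (tensA A' B' D') ∘ tensm f (tensm g h)
      = tensm (tensm f g) h ∘ eqhom (tensA A B D);
  tensm1l : forall (A B : sm_cat) (f : hom A B),
    eqhom (tens1l B) ∘ tensm (idm I1) f = f ∘ eqhom (tens1l A);
  tensm1r : forall (A B : sm_cat) (f : hom A B),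
    eqhom (tens1r B) ∘ tensm f (idm I1) = f ∘ eqhom (tens1r A)
}.

Arguments I1 {s}.
Arguments tens {s} A B.
Arguments tensm {s A B A' B'} f g.
Arguments tensA {s} A B D.
Arguments tens1l {s} A.
Arguments tens1r {s} A.
Notation "A ⊠ B" := (tens A B) : smc_scope.
Notation "f ⊗ g" := (tensm f g) : smc_scope.

Section Identities.
Variable C : strict_monoidal.
Implicit Types A B D : C.

Definition assoc A B D : hom (A ⊠ (B ⊠ D)) ((A ⊠ B) ⊠ D) := eqhom (tensA A B D).
Definition assocV A B D : hom ((A ⊠ B) ⊠ D) (A ⊠ (B ⊠ D)) :=
  eqhom (esym (tensA A B D)).
Definition lunit A : hom (I1 ⊠ A) A := eqhom (tens1l A).
Definition lunitV A : hom A (I1 ⊠ A) := eqhom (esym (tens1l A)).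
Definition runit A : hom (A ⊠ I1) A := eqhom (tens1r A).
Definition runitV A : hom A (A ⊠ I1) := eqhom (esym (tens1r A)).

Definition scale (s : hom (I1 : C) I1) A B (f : hom A B) : hom A B :=
  lunit B ∘ (s ⊗ f) ∘ lunitV A.

End Identities.

Arguments scale {C} s {A B} f.

Notation "s • f" := (scale s f) : smc_scope.
Notation "s •^ k f" := (iter k (scale s) f) : smc_scope.

Record strict_symmetric := StrictSymmetric {
  ss_mon :> strict_monoidal;
  swap : forall A B : ss_mon, hom (A ⊠ B) (B ⊠ A);
  swap_nat : forall (A A' B B' : ss_mon) (f : hom A A') (g : hom B B'),
    swap A' B' ∘ (f ⊗ g) = (g ⊗ f) ∘ swap A B;
  swapK : forall A B : ss_mon, swap B A ∘ swap A B = idm (A ⊠ B);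
  swap1 : forall A : ss_mon, lunit A ∘ swap A I1 = runit A;
  swap_hexagon : forall A B D : ss_mon,
    swap A (B ⊠ D)
      = assoc B D A ∘ (idm B ⊗ swap A D) ∘ assocV B A D
          ∘ (swap A B ⊗ idm D) ∘ assoc A B D
}.

Arguments swap {s} A B.

Record dagger_ssmc := DaggerSSMC {
  ds_sym :> strict_symmetric;
  dag : forall A B : ds_sym, hom A B -> hom B A;
  dag_id : forall A : ds_sym, dag (idm A) = idm A;
  dag_comp : forall (A B D : ds_sym) (g : hom B D) (f : hom A B),
    dag (g ∘ f) = dag f ∘ dag g;
  dagK : forall (A B : ds_sym) (f : hom A B), dag (dag f) = f;
  dag_tens : forall (A B A' B' : ds_sym) (f : hom A B) (g : hom A' B'),
    dag (f ⊗ g) = dag f ⊗ dag g;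
  dag_swap : forall A B : ds_sym, dag (swap A B) = swap B A
}.

Arguments dag {d A B} f.
Notation "f ^†" := (dag f) : smc_scope.

Definition unitary (C : dagger_ssmc) (A B : C) (f : hom A B) : Prop :=
  f^† ∘ f = idm A /\ f ∘ f^† = idm B.

(* Dagger special commutative Frobenius algebras *)
Record dscfa (C : dagger_ssmc) (A : C) := DSCFA {
  mu : hom (A ⊠ A) A;
  eta : hom I1 A;
  muA : mu ∘ (mu ⊗ idm A) ∘ assoc A A A = mu ∘ (idm A ⊗ mu);
  mu_eta_l : mu ∘ (eta ⊗ idm A) ∘ lunitV A = idm A;
  mu_eta_r : mu ∘ (idm A ⊗ eta) ∘ runitV A = idm A;
  muC : mu ∘ swap A A = mu;
  frobenius_l : (mu ⊗ idm A) ∘ assoc A A A ∘ (idm A ⊗ mu^†) = mu^† ∘ mu;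
  frobenius_r : (idm A ⊗ mu) ∘ assocV A A A ∘ (mu^† ⊗ idm A) = mu^† ∘ mu;
  special : mu ∘ mu^† = idm A
}.

Section Interacting.
Variables (C : dagger_ssmc) (A : C).

Definition delta (F : dscfa A) : hom A (A ⊠ A) := (mu F)^†.
Definition epsilon (F : dscfa A) : hom A I1 := (eta F)^†.

Definition tens_pt (psi phi : hom I1 A) : hom I1 (A ⊠ A) :=
  (psi ⊗ phi) ∘ lunitV I1.
Definition tens_copt (psi phi : hom A I1) : hom (A ⊠ A) I1 :=
  lunit I1 ∘ (psi ⊗ phi).

(* id ⊗ swap ⊗ id *)
Definition mid_swap : hom ((A ⊠ A) ⊠ (A ⊠ A)) ((A ⊠ A) ⊠ (A ⊠ A)) :=
  assocV (A ⊠ A) A A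
    ∘ ((assoc A A A ∘ (idm A ⊗ swap A A) ∘ assocV A A A) ⊗ idm A)
    ∘ assoc (A ⊠ A) A A.

Definition link (g r : dscfa A) : hom (I1 : C) I1 := epsilon g ∘ eta r.

(* The scalars in the three bialgebra laws are those forced by speciality of *)
(* both algebras: on the space with basis a finite abelian group of order D, *)
(* where delta_g |i> = |i>|i> and mu_r |i>|j> = D^(-1/2) |i + j>, the scalar *)
(* link is D^(1/2).  No scalar occurs in the last two laws.  When the laws   *)
(* hold without scalars, link acts trivially: see link_trivial.              *)
Record if_structure := IFStructure {
  green : dscfa A;
  red : dscfa A;
  bialg_delta_mu :
    delta green ∘ mu red
      = link green red •
          ((mu red ⊗ mu red) ∘ mid_swap ∘ (delta green ⊗ delta green));
  bialg_delta_eta :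
    link green red • (delta green ∘ eta red) = tens_pt (eta red) (eta red);
  bialg_epsilon_mu :
    link green red • (epsilon green ∘ mu red)
      = tens_copt (epsilon green) (epsilon green);
  eta_red_dual :
    eta red = lunit A ∘ (epsilon red ⊗ idm A) ∘ delta green ∘ eta green;
  epsilon_green_dual :
    epsilon green = epsilon red ∘ mu red ∘ (idm A ⊗ eta green) ∘ runitV A
}.

Section LinkTrivial.

Lemma eqhom_trans (K : category) (X Y Z : K) (e : X = Y) (e' : Y = Z) :
  eqhom e' ∘ eqhom e = eqhom (etrans e e').
Proof. by case: Z / e'; rewrite comp_idl. Qed.

Lemma eqhom_tensl (X Y Z : C) (e : X = Y) :
  eqhom e ⊗ idm Z = eqhom (f_equal (fun V => V ⊠ Z) e).
Proof. by case: Y / e; exact: tensm_id. Qed.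

Lemma scale_tensl (s : hom (I1 : C) I1) (X Y X' Y' : C)
    (f : hom X Y) (g : hom X' Y') : s • (f ⊗ g) = (s • f) ⊗ g.
Proof.
have coh (Z Z' : C) (e : I1 ⊠ (Z ⊠ Z') = Z ⊠ Z') :
    eqhom e = (lunit Z ⊗ idm Z') ∘ assoc I1 Z Z'.
  rewrite /lunit /assoc eqhom_tensl eqhom_trans.
  by congr eqhom; apply: proof_irrelevance.
have cohV (Z Z' : C) (e : Z ⊠ Z' = I1 ⊠ (Z ⊠ Z')) :
    assoc I1 Z Z' ∘ eqhom e = lunitV Z ⊗ idm Z'.
  rewrite /lunitV /assoc eqhom_tensl eqhom_trans.
  by congr eqhom; apply: proof_irrelevance.
rewrite {1}/scale /lunit /lunitV coh -compA (compA (assoc _ _ _)) tensmA.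
rewrite -compA cohV compA -!tensm_comp comp_idl comp_idr /scale.
by rewrite compA.
Qed.

Lemma scale_compl (s : hom (I1 : C) I1) (X Y Z : C) (g : hom Y Z)
    (f : hom X Y) : s • (g ∘ f) = g ∘ (s • f).
Proof.
by rewrite /scale -{1}[s]comp_idl tensm_comp !compA /lunit tensm1l.
Qed.

Lemma eqhomK (K : category) (X Y : K) (e : X = Y) :
  eqhom (esym e) ∘ eqhom e = idm X.
Proof. by case: Y / e; rewrite comp_idl. Qed.

Lemma eqhomVK (K : category) (X Y : K) (e : X = Y) :
  eqhom e ∘ eqhom (esym e) = idm Y.
Proof. by case: Y / e; rewrite comp_idl. Qed.

Lemma scale_compr (s : hom (I1 : C) I1) (X Y Z : C) (g : hom Y Z)
    (f : hom X Y) : s • (g ∘ f) = (s • g) ∘ f.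
Proof.
have nat : (idm I1 ⊗ f) ∘ lunitV X = lunitV Y ∘ f.
  rewrite -[LHS]comp_idl -(eqhomK (tens1l Y)) -!compA; congr (_ ∘ _).
  by rewrite compA tensm1l -compA eqhomVK comp_idr.
by rewrite /scale -{1}[s]comp_idr tensm_comp -!compA nat.
Qed.

Lemma link_trivial (g r : dscfa A) (X Y : C) (f : hom X A) (f' : hom A Y) :
  delta g ∘ eta r = tens_pt (eta r) (eta r) ->
  link g r • (f' ∘ f) = f' ∘ f.
Proof.
move=> copy.
have dag_eqhom (Z Z' : C) (e : Z = Z') : (eqhom e)^† = eqhom (esym e).
  by case: Z' / e; exact: dag_id.
have counit : lunit A ∘ (epsilon g ⊗ idm A) ∘ delta g = idm A.
  have := congr1 (@dag C _ _) (mu_eta_l g).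
  rewrite !dag_comp dag_tens !dag_id /lunitV dag_eqhom esymK => E.
  by rewrite -[RHS]E compA.
have eta1 : link g r • eta r = eta r.
  transitivity (lunit A ∘ (epsilon g ⊗ idm A) ∘ (delta g ∘ eta r)).
    by rewrite copy /scale /tens_pt (compA (_ ⊗ _)) -tensm_comp comp_idl.
  by rewrite !compA -(compA (lunit A)) counit comp_idl.
have id1 : link g r • idm A = idm A.
  by rewrite -{1}(mu_eta_l r) scale_compl scale_compr scale_tensl eta1 mu_eta_l.
by rewrite scale_compl -{1}[f]comp_idl scale_compr id1 comp_idl.
Qed.

End LinkTrivial.

Definition phase (F : dscfa A) (a : hom A A) : Prop :=
  unitary a /\ mu F ∘ (a ⊗ idm A) = a ∘ mu F.

(* The scalar is that of bialg_delta_eta, since eta red must be              *)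
(* green-set-like; dually for eta green and bialg_epsilon_mu.                *)
Definition set_like (s : hom (I1 : C) I1) (F : dscfa A) (psi : hom I1 A) : Prop :=
  s • (delta F ∘ psi) = tens_pt psi psi.

Record phase_group (F : dscfa A) (P : hom A A -> Prop) : Prop := PhaseGroup {
  pg_phase : forall a, P a -> phase F a;
  pg_id : P (idm A);
  pg_comp : forall a b, P a -> P b -> P (a ∘ b);
  pg_inv : forall a, P a -> P (a^†)
}.

Variable F : if_structure.

Definition link_of : hom (I1 : C) I1 := link (green F) (red F).

Record IFK (G H : hom A A -> Prop) : Prop := IFKEquations {
  ifk_green : phase_group (green F) G;
  ifk_green_set_like :
    forall g, G g -> set_like link_of (red F) (g ∘ eta (green F));
  ifk_red : phase_group (red F) H;
  ifk_red_set_like :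
    forall h, H h -> set_like link_of (green F) (h ∘ eta (red F))
}.

Definition enough_green_set_like (H : hom A A -> Prop) : Prop :=
  forall (B : C) (f f' : hom A B),
    (forall h, H h -> f ∘ h ∘ eta (red F) = f' ∘ h ∘ eta (red F)) -> f = f'.

Fixpoint internal_int (n : nat) : hom A A :=
  match n with
  | 0 => eta (red F) ∘ epsilon (green F)
  | k.+1 => mu (red F) ∘ (internal_int k ⊗ idm A) ∘ delta (green F)
  end.

End Interacting.

Section Exponent.
Variables (C : category) (A : C) (H : hom A A -> Prop).

Definition finite_homs : Prop :=
  exists (k : nat) (e : 'I_k -> hom A A), forall h, H h -> exists i, h = e i.

Definition killed_by (d : nat) : Prop :=
  forall h, H h -> iter d (comp h) (idm A) = idm A.

Definition is_exponent (d : nat) : Prop :=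
  [/\ 0 < d, killed_by d & forall e, 0 < e -> killed_by e -> d <= e].

End Exponent.

(* Main.v *)
(* Write psi_h = h eta_r for h in H_K and s = epsilon_g eta_r.  Set-likeness
   gives s^n N_{n+1} psi_h = psi_{h^(n+1)}; at n = d this shows that s acts
   invertibly on A, so up to scalars N_n is the map Q_n : psi_h |-> psi_{h^n}.
   Put x_a = epsilon_r a eta_r (the amplitude <psi_1|psi_a>).  The operator
   mu_g (eta_r (x) id) is self-adjoint and sends psi_a to x_a psi_a up to s;
   comparing matrix elements gives x_a psi_a = x_a psi_1, hence
   x_a psi_{a^j} = x_a psi_1 for all j.  If n is invertible mod d this forces
   x_{a^n} = x_a, so the adjoint of Q_n is Q_m with m the inverse of n; as every
   Q_m preserves mu_r and delta_g, taking adjoints gives (2) and (3).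
   Conversely (2) or (3) makes x_k act as x_1 = s^2 whenever k^n = 1, so that
   psi_k = psi_1 and k = 1; thus h |-> h^n is injective on H_K, which forces n to
   be coprime to the exponent. *)

From Stdlib Require Import ProofIrrelevance.
From mathcomp Require Import all_boot.
Require Import Defs.

Set Implicit Arguments.
Unset Strict Implicit.
Unset Printing Implicit Defensive.

(** * Strict coherence: structural maps are [eqhom]s, and parallel ones agree by proof
    irrelevance *)

Section StrictMonoidal.
Variable C : strict_monoidal.
Implicit Types X Y Z : C.

Lemma eqhom_tensr X Y Z (e : Y = Z) :
  idm X ⊗ eqhom e = eqhom (f_equal (fun V => X ⊠ V) e).
Proof. by case: Z / e; exact: tensm_id. Qed.

Lemma assocK X Y Z : assocV X Y Z ∘ assoc X Y Z = idm _.
Proof. exact: eqhomK. Qed.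

Lemma assocVK X Y Z : assoc X Y Z ∘ assocV X Y Z = idm _.
Proof. exact: eqhomVK. Qed.

Lemma lunitK X : lunitV X ∘ lunit X = idm _. Proof. exact: eqhomK. Qed.
Lemma lunitVK X : lunit X ∘ lunitV X = idm _. Proof. exact: eqhomVK. Qed.
Lemma runitK X : runitV X ∘ runit X = idm _. Proof. exact: eqhomK. Qed.
Lemma runitVK X : runit X ∘ runitV X = idm _. Proof. exact: eqhomVK. Qed.

Lemma lunitV_nat X Y (f : hom X Y) : lunitV Y ∘ f = (idm I1 ⊗ f) ∘ lunitV X.
Proof.
by rewrite -[RHS]comp_idl -lunitK -!compA [lunit Y ∘ _]compA tensm1l -compA lunitVK
  comp_idr.
Qed.

Lemma runitV_nat X Y (f : hom X Y) : runitV Y ∘ f = (f ⊗ idm I1) ∘ runitV X.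
Proof.
by rewrite -[RHS]comp_idl -runitK -!compA [runit Y ∘ _]compA tensm1r -compA runitVK
  comp_idr.
Qed.

Lemma assocV_nat X X' Y Y' Z Z' (f : hom X X') (g : hom Y Y') (h : hom Z Z') :
  assocV X' Y' Z' ∘ ((f ⊗ g) ⊗ h) = (f ⊗ (g ⊗ h)) ∘ assocV X Y Z.
Proof.
rewrite -[LHS]comp_idr -(assocVK X Y Z) -!compA [(f ⊗ g ⊗ h) ∘ _]compA -tensmA.
by rewrite !compA -/(assoc X' Y' Z') assocK comp_idl.
Qed.

Lemma lunit_runit : lunit (I1 : C) = runit I1.
Proof. by congr eqhom; apply: proof_irrelevance. Qed.

Lemma lunitV_runitV : lunitV (I1 : C) = runitV I1.
Proof. by congr eqhom; apply: proof_irrelevance. Qed.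

Lemma tens_split X X' Y Y' (f : hom X X') (g : hom Y Y') :
  f ⊗ g = (f ⊗ idm Y') ∘ (idm X ⊗ g).
Proof. by rewrite -tensm_comp comp_idl comp_idr. Qed.

Lemma tens_splitr X X' Y Y' (f : hom X X') (g : hom Y Y') :
  f ⊗ g = (idm X' ⊗ g) ∘ (f ⊗ idm Y).
Proof. by rewrite -tensm_comp comp_idl comp_idr. Qed.

End StrictMonoidal.

(** * The action of endomorphisms of the unit on morphisms *)

Section Scalars.
Variable C : dagger_ssmc.
Implicit Types (X Y Z : C) (u v : hom (I1 : C) I1).

Lemma dag_eqhom X Y (e : X = Y) : (eqhom e)^† = eqhom (esym e).
Proof. by case: Y / e; exact: dag_id. Qed.

Lemma scale_idE u : u • idm I1 = u.
Proof.
rewrite /scale lunit_runit lunitV_runitV compA tensm1r -compA.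
by rewrite runitVK comp_idr.
Qed.

Lemma scale_pt u X (f : hom I1 X) : u • f = f ∘ u.
Proof. by rewrite -{1}[f]comp_idr scale_compl scale_idE. Qed.

Lemma scale_copt u X (f : hom X I1) : u • f = u ∘ f.
Proof. by rewrite -{1}[f]comp_idl scale_compr scale_idE. Qed.

(** Eckmann-Hilton: on scalars, [scale] is composition on either side. *)
Lemma scalarC u v : u ∘ v = v ∘ u.
Proof. by rewrite -scale_pt scale_copt. Qed.

Lemma scale_id_compr u X Y (f : hom X Y) : u • f = f ∘ (u • idm X).
Proof. by rewrite -scale_compl comp_idr. Qed.

Lemma scale_id_compl u X Y (f : hom X Y) : u • f = (u • idm Y) ∘ f.
Proof. by rewrite -scale_compr comp_idl. Qed.

Lemma scaleC u v X Y (f : hom X Y) : u • (v • f) = v • (u • f).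
Proof.
by rewrite [v • f]scale_id_compr scale_compr -scale_id_compr.
Qed.

Lemma scale_comp u v X Y (f : hom X Y) : (u ∘ v) • f = u • (v • f).
Proof.
rewrite [RHS]scale_id_compl /scale -[f in LHS]comp_idl tensm_comp -!compA.
by rewrite [lunitV Y ∘ _]compA lunitK comp_idl.
Qed.

Lemma scale_tensr u X Y X' Y' (f : hom X Y) (g : hom X' Y') :
  u • (f ⊗ g) = f ⊗ (u • g).
Proof.
have E (k : hom X' Y') : f ⊗ k = swap Y' Y ∘ (k ⊗ f) ∘ swap X X'.
  by rewrite compA swap_nat -compA swapK comp_idr.
by rewrite (E g) (E (u • g)) scale_compl scale_compr scale_tensl.
Qed.

Lemma dag_scale u X Y (f : hom X Y) : (u • f)^† = u^† • f^†.
Proof.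
by rewrite /scale !dag_comp dag_tens /lunitV /lunit !dag_eqhom esymK compA.
Qed.

Lemma iter_scale_compl u k X Y Z (g : hom Y Z) (f : hom X Y) :
  u •^k (g ∘ f) = g ∘ (u •^k f).
Proof. by elim: k => //= k ->; rewrite scale_compl. Qed.

Lemma iter_scale_compr u k X Y Z (g : hom Y Z) (f : hom X Y) :
  u •^k (g ∘ f) = (u •^k g) ∘ f.
Proof. by elim: k => //= k ->; rewrite scale_compr. Qed.

Lemma iter_scale_tensl u k X Y X' Y' (f : hom X Y) (g : hom X' Y') :
  u •^k (f ⊗ g) = (u •^k f) ⊗ g.
Proof. by elim: k => //= k ->; rewrite scale_tensl. Qed.

Lemma iter_scale_tensr u k X Y X' Y' (f : hom X Y) (g : hom X' Y') :
  u •^k (f ⊗ g) = f ⊗ (u •^k g).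
Proof. by elim: k => //= k ->; rewrite scale_tensr. Qed.

Lemma scale_iterC u v k X Y (f : hom X Y) : u • (v •^k f) = v •^k (u • f).
Proof. by elim: k => //= k <-; rewrite scaleC. Qed.

End Scalars.

(** * Self-duality of a Frobenius algebra *)

Section Frobenius.
Variables (C : dagger_ssmc) (A : C) (M : dscfa A).

Lemma counit_l : lunit A ∘ (epsilon M ⊗ idm A) ∘ delta M = idm A.
Proof.
have := congr1 (@dag C _ _) (mu_eta_l M).
by rewrite !dag_comp dag_tens !dag_id /lunitV dag_eqhom esymK -compA.
Qed.

Lemma counit_r : runit A ∘ (idm A ⊗ epsilon M) ∘ delta M = idm A.
Proof.
have := congr1 (@dag C _ _) (mu_eta_r M).
by rewrite !dag_comp dag_tens !dag_id /runitV dag_eqhom esymK -compA.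
Qed.

Definition cup : hom I1 (A ⊠ A) := delta M ∘ eta M.
Definition cap : hom (A ⊠ A) I1 := epsilon M ∘ mu M.

Lemma snake :
  runit A ∘ (idm A ⊗ cap) ∘ assocV A A A ∘ (cup ⊗ idm A) ∘ lunitV A = idm A.
Proof.
rewrite /cup /cap.
have -> : idm A ⊗ (epsilon M ∘ mu M) = (idm A ⊗ epsilon M) ∘ (idm A ⊗ mu M).
  by rewrite -tensm_comp comp_idl.
have -> : (delta M ∘ eta M) ⊗ idm A = (delta M ⊗ idm A) ∘ (eta M ⊗ idm A).
  by rewrite -tensm_comp comp_idl.
have F : (idm A ⊗ mu M) ∘ assocV A A A ∘ (delta M ⊗ idm A) = delta M ∘ mu M.
  exact: frobenius_r.
rewrite -!compA [assocV A A A ∘ _]compA [(idm A ⊗ mu M) ∘ _]compA F -!compA.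
by rewrite mu_eta_l comp_idr counit_r.
Qed.

(** The second input becomes an output, because enough set-like elements separate only morphisms
    with source [A]. *)
Definition bend (B : C) (f : hom (A ⊠ A) B) : hom A (B ⊠ A) :=
  (f ⊗ idm A) ∘ assoc A A A ∘ (idm A ⊗ cup) ∘ runitV A.


Lemma bend_pt (B : C) (f : hom (A ⊠ A) B) (a : hom I1 A) :
  bend f ∘ a = ((f ∘ (a ⊗ idm A) ∘ lunitV A) ⊗ idm A) ∘ cup.
Proof.
have E : assoc I1 A A ∘ (idm I1 ⊗ cup) ∘ runitV I1 = (lunitV A ⊗ idm A) ∘ cup.
  rewrite -lunitV_runitV -lunitV_nat compA; congr (_ ∘ _).
  rewrite /lunitV /assoc eqhom_tensl eqhom_trans.
  by congr eqhom; apply: proof_irrelevance.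
rewrite /bend -!compA runitV_nat [(idm A ⊗ cup) ∘ _]compA -tens_splitr.
rewrite (tens_split a) -[idm (A ⊠ A)]tensm_id -!compA.
rewrite [assoc A A A ∘ _]compA tensmA -!compA -/(assoc I1 A A) E !compA.
by rewrite -!tensm_comp !comp_idl -?compA.
Qed.

Lemma bend_inj (B : C) (f f' : hom (A ⊠ A) B) : bend f = bend f' -> f = f'.
Proof.
suff unbend g : runit B ∘ (idm B ⊗ cap) ∘ assocV B A A ∘ (bend g ⊗ idm A) = g.
  by move=> E; rewrite -(unbend f) E unbend.
have -> : bend g ⊗ idm A = ((g ⊗ idm A) ⊗ idm A) ∘ (assoc A A A ⊗ idm A)
    ∘ ((idm A ⊗ cup) ⊗ idm A) ∘ (runitV A ⊗ idm A).
  by rewrite -!tensm_comp !comp_idl.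
rewrite [assocV B A A ∘ _]compA assocV_nat tensm_id -!compA.
rewrite [(idm B ⊗ cap) ∘ _]compA -tens_splitr (tens_split g).
rewrite -!compA [runit B ∘ _]compA tensm1r -!compA -[RHS]comp_idr.
congr (_ ∘ _).
have coh1 : eqhom (tens1r (A ⊠ A)) = (idm A ⊗ runit A) ∘ assocV A A I1.
  rewrite /runit /assocV eqhom_tensr eqhom_trans.
  by congr eqhom; apply: proof_irrelevance.
have coh2 : assocV A A (A ⊠ A) ∘ assocV (A ⊠ A) A A ∘ (assoc A A A ⊗ idm A)
    = (idm A ⊗ assocV A A A) ∘ assocV A (A ⊠ A) A.
  rewrite /assocV /assoc eqhom_tensr eqhom_tensl !eqhom_trans.
  by congr eqhom; apply: proof_irrelevance.
have coh3 : assocV A I1 A ∘ (runitV A ⊗ idm A) = idm A ⊗ lunitV A.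
  rewrite /assocV /runitV /lunitV eqhom_tensr eqhom_tensl !eqhom_trans.
  by congr eqhom; apply: proof_irrelevance.
rewrite coh1 -tensm_id -!compA [assocV A A I1 ∘ _]compA assocV_nat -!compA.
rewrite [assocV (A ⊠ A) A A ∘ _]compA [assocV A A (A ⊠ A) ∘ _]compA.
rewrite coh2 -!compA [assocV A (A ⊠ A) A ∘ _]compA assocV_nat -!compA coh3.
by rewrite -!tensm_comp !comp_idl snake.
Qed.

End Frobenius.

(** * Phases of a Frobenius algebra *)

Section Phases.
Variables (C : dagger_ssmc) (A : C) (M : dscfa A).

Lemma phase_mu_pt a :
  phase M a -> mu M ∘ ((a ∘ eta M) ⊗ idm A) ∘ lunitV A = a.
Proof.
case=> _ E; rewrite -[idm A]comp_idl tensm_comp -!compA [mu M ∘ _]compA E -compA.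
by rewrite mu_eta_l comp_idr.
Qed.

(** Commutativity of [mu] lets [a] enter on the left leg and [b] on the right, where they commute by
    interchange; the unit law then removes [mu]. *)
Lemma phaseC a b : phase M a -> phase M b -> a ∘ b = b ∘ a.
Proof.
case=> _ Ea [_ Eb].
have Eb' : mu M ∘ (idm A ⊗ b) = b ∘ mu M.
  by rewrite -{1}(muC M) -compA swap_nat compA Eb -compA muC.
have Eab : (a ∘ b) ∘ mu M = (b ∘ a) ∘ mu M.
  rewrite -!compA -{1}Eb' -{1}Ea [LHS]compA [RHS]compA -Ea -Eb'.
  by rewrite -!compA -tens_split -tens_splitr.
by rewrite -[LHS]comp_idr -[RHS]comp_idr -(mu_eta_l M) !compA Eab.
Qed.

End Phases.

(** * Powers in a phase group and its exponent *)

Section Powers.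
Variables (C : dagger_ssmc) (A : C).
Implicit Types h k : hom A A.

Definition hpow h n : hom A A := iter n (comp h) (idm A).

Lemma hpowS h n : hpow h n.+1 = h ∘ hpow h n. Proof. by []. Qed.

Lemma hpowD h m n : hpow h (m + n) = hpow h m ∘ hpow h n.
Proof. by elim: m => [|m IH]; rewrite ?comp_idl // addSn !hpowS IH compA. Qed.

Lemma hpow1 h : hpow h 1 = h. Proof. exact: comp_idr. Qed.

Lemma hpowSr h n : hpow h n.+1 = hpow h n ∘ h.
Proof. by rewrite -addn1 hpowD hpow1. Qed.

Lemma hpow_id n : hpow (idm A) n = idm A.
Proof. by elim: n => // n IH; rewrite hpowS IH comp_idl. Qed.

Lemma hpowM h m n : hpow h (m * n) = hpow (hpow h m) n.
Proof. by elim: n => [|n IH]; rewrite ?muln0 // mulnS hpowD IH. Qed.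

Lemma hpow_comp h k n :
  h ∘ k = k ∘ h -> hpow (h ∘ k) n = hpow h n ∘ hpow k n.
Proof.
move=> E; elim: n => [|n IH]; first by rewrite comp_idl.
have Ek : k ∘ hpow h n = hpow h n ∘ k.
  elim: n {IH} => [|n IH]; first by rewrite comp_idl comp_idr.
  by rewrite hpowS compA -E -compA IH compA.
by rewrite !hpowS IH -!compA [k ∘ _]compA Ek -compA.
Qed.

Lemma dag_hpow h n : (hpow h n)^† = hpow (h^†) n.
Proof.
by elim: n => [|n IH]; [exact: dag_id | rewrite hpowS dag_comp IH hpowSr].
Qed.

Variable H : hom A A -> Prop.

Lemma hpow_mem (M : dscfa A) n h : phase_group M H -> H h -> H (hpow h n).
Proof.
move=> HG Hh; elim: n => [|n IH]; first exact: pg_id HG.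
exact: (pg_comp HG).
Qed.

Lemma coprime_hpow_inv d n : killed_by H d -> coprime d n ->
  exists m, forall h, H h -> hpow h (n * m) = h.
Proof.
move=> Hd cop; case: n cop => [|n] cop.
  (* Coprimality with 0 forces [d = 1], so the group is trivial. *)
  exists 0 => h Hh; move: cop; rewrite /coprime gcdn0 => /eqP d1.
  by rewrite -[RHS]hpow1 -d1; symmetry; exact: Hd.
(* Bezout without subtraction: [1 + a * d = m * n.+1]. *)
have [a _] := Bezoutr d (ltn0Sn n); rewrite (eqP cop) => /dvdnP[m E].
exists m => h Hh; rewrite mulnC -E hpowD hpow1 mulnC hpowM.
by rewrite [hpow h d]Hd // hpow_id comp_idr.
Qed.

(* For a common prime factor p of d and n, the n-th power map kills every
   h^(d/p), contradicting the minimality of d. *)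
Lemma hpow_faithful_coprime (M : dscfa A) d n :
  phase_group M H -> is_exponent H d ->
  (forall h, H h -> hpow h n = idm A -> h = idm A) -> coprime d n.
Proof.
move=> HG [d0 Hd dmin] faith; apply/negPn/negP => ncop.
have g1 : 1 < gcdn d n.
  by rewrite ltn_neqAle eq_sym gcdn_gt0 d0 andbT.
have pp := pdiv_prime g1; set p := pdiv _ in pp.
have /dvdnP[e Ee] : p %| d by apply: dvdn_trans (pdiv_dvd _) (dvdn_gcdl _ _).
have /dvdnP[f Ef] : p %| n by apply: dvdn_trans (pdiv_dvd _) (dvdn_gcdr _ _).
have e0 : 0 < e by move: d0; rewrite Ee muln_gt0 => /andP[].
have: d <= e.
  apply: dmin => // h Hh; apply: faith; first exact: hpow_mem HG Hh.
  by rewrite Ef mulnC hpowM -[hpow (iter _ _ _) p]hpowM -Ee [hpow h d]Hd // hpow_id.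
by rewrite Ee leqNgt -{1}[e]muln1 ltn_pmul2l // prime_gt1.
Qed.

End Powers.

(** * Internal integers on green-set-like elements, and invertibility of the link scalar *)

Section GreenSetLike.
Variables (C : dagger_ssmc) (A : C) (F : if_structure A) (H : hom A A -> Prop).
Hypothesis HG : phase_group (red F) H.
Hypothesis HS : forall h, H h -> set_like (link_of F) (green F) (h ∘ eta (red F)).
Hypothesis enough : enough_green_set_like F H.

Local Notation s := (link_of F).
Local Notation mu_g := (mu (green F)).
Local Notation mu_r := (mu (red F)).
Local Notation eta_r := (eta (red F)).
Local Notation eta_g := (eta (green F)).
Local Notation delta_g := (delta (green F)).
Local Notation delta_r := (delta (red F)).
Local Notation epsilon_g := (epsilon (green F)).
Local Notation epsilon_r := (epsilon (red F)).
Local Notation N := (internal_int F).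

Lemma phase_groupC h k : H h -> H k -> h ∘ k = k ∘ h.
Proof. by move=> /(pg_phase HG) hP /(pg_phase HG) kP; exact: phaseC hP kP. Qed.

(** Each further step copies the point with [delta_g], at the cost of one [s], and multiplies one
    copy in with [mu_r]. The count starts at [N 1], which is the identity by the unit and counit
    laws. *)
Lemma internal_int_pt k h : H h ->
  s •^k (N k.+1 ∘ h ∘ eta_r) = hpow h k.+1 ∘ eta_r.
Proof.
move=> Hh; elim: k => [|k IH].
  rewrite hpow1 /=; rewrite -[idm A]comp_idl tensm_comp.
  have -> : (epsilon_g ⊗ idm A) = lunitV A ∘ lunit A ∘ (epsilon_g ⊗ idm A).
    by rewrite compA lunitK comp_idl.
  rewrite -!compA [(epsilon_g ⊗ _) ∘ _]compA [lunit A ∘ _]compA counit_l.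
  by rewrite comp_idl !compA -(compA mu_r) mu_eta_l comp_idl.
have /(pg_phase HG)/phase_mu_pt := hpow_mem k.+1 HG Hh.
rewrite iterSr (hpowSr h k.+1); set Nk := N k.+1 in IH *.
move: (hpow h k.+1) IH => P IH PE.
rewrite -[N k.+2]/(mu_r ∘ (Nk ⊗ idm A) ∘ delta_g) -!compA.
rewrite 2!scale_compl (HS Hh) /tens_pt [(Nk ⊗ _) ∘ _]compA.
rewrite -tensm_comp comp_idl tens_split -compA -lunitV_nat iter_scale_compl.
rewrite iter_scale_compr iter_scale_tensl IH -[in RHS]PE.
by rewrite -!compA.
Qed.

Lemma link_invertible d : 0 < d -> killed_by H d ->
  (* The map [z] inverts [s] because [s •^d (N d.+1)] sends each point of [h] to that of
     [h^(d+1) = h]. *)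
  exists kappa, kappa • (s • idm A) = idm A.
Proof.
move=> d0 Hd; pose z := s •^(d.-1) (N d.+1).
have zP : s • z = idm A.
  apply: enough => h Hh; rewrite comp_idl /z -iterS prednK // -iter_scale_compr.
  by rewrite internal_int_pt // hpowSr [hpow h d]Hd // comp_idl.
have [kappa kE] : exists kappa, s ∘ s ∘ kappa = s.
  (* Two factors [s] cancel the two [z], leaving [epsilon_g ∘ eta_r = s]. The resulting scalar
     inverts [s] in its action on [A]. *)
  exists (epsilon_g ∘ z ∘ z ∘ eta_r).
  have K (f : hom I1 A) : s • (epsilon_g ∘ z ∘ f) = epsilon_g ∘ f.
    by rewrite scale_compl scale_compr zP comp_idl.
  by rewrite -!scale_copt !K.
exists kappa; rewrite -zP; transitivity ((s ∘ s ∘ kappa) • z); last by rewrite kE.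
by rewrite !scale_comp -!(scaleC kappa).
Qed.

(** * Cancelling the link scalar, and the normalised power maps *)

Section Kappa.
Variable kappa : hom (I1 : C) I1.
Hypothesis kappaP : kappa • (s • idm A) = idm A.

Lemma scaleKl X (f : hom X A) : kappa • (s • f) = f.
Proof. by rewrite [s • f]scale_id_compl scale_compr kappaP comp_idl. Qed.

Lemma scaleKr Y (f : hom A Y) : kappa • (s • f) = f.
Proof. by rewrite [s • f]scale_id_compr scale_compl kappaP comp_idr. Qed.

Lemma iter_scaleIl n X (f f' : hom X A) : s •^n f = s •^n f' -> f = f'.
Proof.
by elim: n => //= n IH /(congr1 (scale kappa)); rewrite !scaleKl.
Qed.

Lemma iter_scaleIr n Y (f f' : hom A Y) : s •^n f = s •^n f' -> f = f'.
Proof.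
by elim: n => //= n IH /(congr1 (scale kappa)); rewrite !scaleKr.
Qed.

(** The unit law of [mu_r] rebuilds the identity from [eta_r], so a scalar's action on [A] can be
    read off [eta_r]. *)
Lemma scale_idm_eta u v : eta_r ∘ u = eta_r ∘ v -> u • idm A = v • idm A.
Proof.
have K w : w • idm A = mu_r ∘ ((eta_r ∘ w) ⊗ idm A) ∘ lunitV A.
  by rewrite -{1}(mu_eta_l (red F)) scale_compl scale_compr scale_tensl scale_pt.
by move=> E; rewrite !K E.
Qed.

(** Discard one copy in the set-likeness equation with [epsilon_g], then undo [h] by unitarity. *)
Lemma epsilon_g_set_like h : H h -> eta_r ∘ epsilon_g ∘ h ∘ eta_r = s • eta_r.
Proof.
move=> Hh; have [U _] := (pg_phase HG Hh).1.
have: lunit A ∘ (epsilon_g ⊗ idm A) ∘ (s • (delta_g ∘ h ∘ eta_r))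
    = lunit A ∘ (epsilon_g ⊗ idm A) ∘ tens_pt (h ∘ eta_r) (h ∘ eta_r).
  by rewrite (HS Hh).
rewrite -!scale_compl !compA -(compA (lunit A)) counit_l comp_idl.
rewrite /tens_pt -!compA [(epsilon_g ⊗ _) ∘ _]compA -tensm_comp comp_idl.
rewrite -/(scale _ _) [in RHS]scale_pt => /(congr1 (comp (h^†))).
by rewrite -scale_compl -!compA !(compA (h^†)) U !comp_idl => <-.
Qed.

(** Writing [h] as red multiplication by its point, the bialgebra law for [epsilon_g] splits off the
    scalar [epsilon_g ∘ h ∘ eta_r], which acts as [s]. *)
Lemma epsilon_g_phase h : H h -> epsilon_g ∘ h = epsilon_g.
Proof.
move=> Hh; apply: (@iter_scaleIr 1) => /=.
rewrite -{1}(phase_mu_pt (pg_phase HG Hh)) compA scale_compr.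
rewrite bialg_epsilon_mu /tens_copt -!compA [(epsilon_g ⊗ _) ∘ _]compA.
rewrite -tensm_comp comp_idr -/(scale _ _).
rewrite [LHS]scale_id_compr [RHS]scale_id_compr; congr (_ ∘ _).
by apply: scale_idm_eta; rewrite epsilon_g_set_like // scale_pt.
Qed.

Lemma power_map_exists : exists Q : nat -> hom A A,
  (forall n, s • Q n = s •^n (N n)) /\
  (forall n h, H h -> Q n ∘ h ∘ eta_r = hpow h n ∘ eta_r).
Proof.
exists (fun n => kappa • (s •^n (N n))); split=> [n|n h Hh].
  by rewrite scaleC scaleKl.
rewrite -scale_compr; case: n => [|n].
  by rewrite /= -!compA epsilon_g_set_like // scaleKl comp_idl.
by rewrite [in LHS]iterS -scale_compr -iter_scale_compr internal_int_pt // scaleKl.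
Qed.

(** * The operator [proj_eta], in the group-basis model a multiple of the projection onto [eta_r],
    and amplitudes *)

Definition proj_eta : hom A A := mu_g ∘ (eta_r ⊗ idm A) ∘ lunitV A.

Lemma dag_proj_etaE : proj_eta^† = lunit A ∘ (epsilon_r ⊗ idm A) ∘ delta_g.
Proof.
by rewrite /proj_eta !dag_comp dag_tens dag_id /lunitV dag_eqhom esymK -compA.
Qed.

(** By [eta_red_dual], [eta_r] is the green transpose of [epsilon_r]; the Frobenius law turns
    multiplying by the former into comultiplying and applying the latter. *)
Lemma proj_eta_self_adjoint : proj_eta^† = proj_eta.
Proof.
rewrite dag_proj_etaE /proj_eta {1}eta_red_dual.
have D : delta_g = (idm A ⊗ mu_g) ∘ assocV A A A ∘ (delta_g ⊗ idm A)
    ∘ (eta_g ⊗ idm A) ∘ lunitV A.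
  rewrite -[LHS]comp_idr -[X in delta_g ∘ X = _](mu_eta_l (green F)) compA.
  by rewrite -[delta_g ∘ mu_g]frobenius_r -!compA.
rewrite {1}D {D}.
have coh : lunit (A ⊠ A) ∘ assocV I1 A A = lunit A ⊗ idm A.
  rewrite /lunit /assocV eqhom_tensl eqhom_trans.
  by congr eqhom; apply: proof_irrelevance.
have -> : (lunit A ∘ (epsilon_r ⊗ idm A) ∘ delta_g ∘ eta_g) ⊗ idm A
  = (lunit A ⊗ idm A) ∘ ((epsilon_r ⊗ idm A) ⊗ idm A) ∘ (delta_g ⊗ idm A)
      ∘ (eta_g ⊗ idm A) by rewrite -!tensm_comp !comp_idl.
rewrite -coh -!compA [assocV I1 A A ∘ _]compA assocV_nat tensm_id -!compA.
rewrite [mu_g ∘ _]compA -tensm1l -!compA [(idm I1 ⊗ mu_g) ∘ _]compA.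
rewrite -tens_splitr [(epsilon_r ⊗ idm A) ∘ _]compA.
by rewrite -tensm_comp comp_idl comp_idr.
Qed.

Definition amp g : hom (I1 : C) I1 := epsilon_r ∘ g ∘ eta_r.

Lemma proj_eta_pt a : H a -> s • (proj_eta ∘ a ∘ eta_r) = a ∘ eta_r ∘ amp a.
Proof.
move=> Ha; rewrite -proj_eta_self_adjoint dag_proj_etaE -!compA 2!scale_compl.
rewrite (HS Ha) /tens_pt [(epsilon_r ⊗ _) ∘ _]compA -tensm_comp comp_idl.
by rewrite -/(scale _ _) scale_pt -!compA.
Qed.

(** Expanding [epsilon_g] by its red dual and absorbing [eta_r] as a unit gives
    [s = epsilon_r ∘ eta_g]. *)
Lemma dag_link : s^† = s.
Proof.
have E : mu_r ∘ (idm A ⊗ eta_g) ∘ runitV A ∘ eta_r = eta_g.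
  rewrite runitV_nat [(idm A ⊗ _) ∘ _]compA -tens_splitr tens_split.
  rewrite -compA -lunitV_runitV -lunitV_nat !compA -(compA mu_r).
  by rewrite mu_eta_l comp_idl.
by rewrite /link_of /link {2}epsilon_green_dual -!compA E dag_comp dagK.
Qed.

Lemma dag_amp g : (amp g)^† = amp (g^†).
Proof. by rewrite /amp !dag_comp dagK -compA. Qed.

(** The matrix element [s • (epsilon_r ∘ u ∘ proj_eta ∘ a ∘ eta_r)], evaluated by the eigenvector
    equation on the right and by its adjoint on the left. *)
Lemma amp_rel u a : H u -> H a -> amp (u ∘ a) ∘ amp a = amp (u ∘ a) ∘ amp u.
Proof.
move: proj_eta_pt proj_eta_self_adjoint; move: proj_eta => P Ppt Pd Hu Ha.
have E : s • (epsilon_r ∘ u ∘ P) = amp u ∘ epsilon_r ∘ u.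
  have := Ppt _ (pg_inv HG Hu); have := dag_amp (u^†); rewrite dagK.
  move: (amp (u^†)) => t Et /(congr1 (@dag _ _ _)).
  rewrite dag_scale dag_link !dag_comp Et dagK.
  by rewrite Pd -!compA.
transitivity (epsilon_r ∘ u ∘ (s • (P ∘ a ∘ eta_r))).
  by rewrite Ppt // /amp -!compA.
rewrite -2!scale_compl [u ∘ _]compA [epsilon_r ∘ _]compA scale_compr E.
by rewrite scalarC /amp -!compA.
Qed.

Lemma scale_idm_ext u v : u • idm A = v • idm A ->
  forall X (f : hom X A), u • f = v • f.
Proof. by move=> E X f; rewrite scale_id_compl E -scale_id_compl. Qed.

(** Since [eta_r] is set-like and green is special, [proj_eta ∘ eta_r] is [s • eta_r]; compare with
    the eigenvector equation. *)
Lemma amp1E X (f : hom X A) : amp (idm A) • f = s • (s • f).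
Proof.
rewrite -scale_comp; move: X f; apply: scale_idm_ext; apply: scale_idm_eta.
have := proj_eta_pt (pg_id HG); rewrite !comp_idl => <-.
rewrite /proj_eta -!compA lunitV_nat [(_ ⊗ idm A) ∘ _]compA -tens_split.
have := HS (pg_id HG); rewrite comp_idl /set_like /tens_pt => <-.
by rewrite -scale_compl compA special comp_idl !scale_pt /link_of /link -!compA.
Qed.

Lemma amp1K X (f : hom X A) : kappa • (kappa • (amp (idm A) • f)) = f.
Proof. by rewrite amp1E !scaleKl. Qed.

Lemma scale_amp_dag a X (f : hom X A) : H a -> amp (a^†) • f = amp a • f.
Proof.
move=> Ha; have [U _] := (pg_phase HG Ha).1.
have E := amp_rel (pg_inv HG Ha) Ha; rewrite U in E.
by rewrite -[LHS]amp1K -[RHS]amp1K; do 2 congr (_ • _); rewrite -!scale_comp E.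
Qed.

Lemma coenough X (f f' : hom X A) :
  (forall h, H h -> epsilon_r ∘ h ∘ f = epsilon_r ∘ h ∘ f') -> f = f'.
Proof.
move=> E; rewrite -[f]dagK -[f']dagK; congr dag; apply: enough => h Hh.
have /(congr1 (@dag _ _ _)) := E _ (pg_inv HG Hh).
by rewrite !dag_comp !dagK -!compA.
Qed.

(* On the group-basis model, amp a vanishes unless a is the identity. *)
Lemma amp_pt a : H a -> a ∘ eta_r ∘ amp a = eta_r ∘ amp a.
Proof.
move=> Ha; have [_ U] := (pg_phase HG Ha).1.
apply: coenough => b Hb.
transitivity (amp (b ∘ a) ∘ amp a); first by rewrite /amp -!compA.
have E := amp_rel (pg_comp HG Hb Ha) (pg_inv HG Ha).
rewrite -compA U comp_idr in E.
rewrite amp_rel // scalarC -E scalarC -scale_copt {2}/amp.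
by rewrite scale_compl scale_amp_dag // scale_pt -!compA.
Qed.

Lemma amp_hpow_pt a j : H a -> hpow a j ∘ eta_r ∘ amp a = eta_r ∘ amp a.
Proof.
move=> Ha; elim: j => [|j IH]; first by rewrite comp_idl.
by rewrite hpowSr -compA amp_pt.
Qed.

(** As [g^n] is a power of [g] and [g] one of [g^n], the product of both amplitudes equals
    [amp (idm A)] times either one. *)
Lemma amp_hpow n m g : (forall h, H h -> hpow h (n * m) = h) -> H g ->
  amp (hpow g n) = amp g.
Proof.
move=> nm Hg; have Hgn := hpow_mem n HG Hg.
have E1 : amp (hpow g n) ∘ amp g = amp (idm A) ∘ amp g.
  by rewrite /amp -!compA comp_idl amp_hpow_pt.
have E2 : amp g ∘ amp (hpow g n) = amp (idm A) ∘ amp (hpow g n).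
  by rewrite -{1}(nm g Hg) hpowM /amp -!compA comp_idl amp_hpow_pt.
(* Cancellation holds on morphisms into or out of [A]; [amp h] factors through [A]. *)
have K (h : hom A A) : kappa • (kappa • (amp (idm A) ∘ amp h)) = amp h.
  by rewrite -scale_copt {2}/amp 3!scale_compl amp1K.
by rewrite -[LHS]K -[RHS]K -E1 -E2 scalarC.
Qed.

Lemma amp_faithful k : H k -> eta_r ∘ amp k = eta_r ∘ amp (idm A) -> k = idm A.
Proof.
move=> Hk E.
have Ek : k ∘ eta_r = eta_r.
  rewrite -[LHS]amp1K -[RHS]amp1K; do 2 congr (_ • _).
  by rewrite !scale_pt -compA -E amp_pt.
by rewrite -(phase_mu_pt (pg_phase HG Hk)) Ek mu_eta_l.
Qed.

(** * Power maps as homomorphisms, and their adjoints *)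

Section PowerMap.
Variable Q : nat -> hom A A.
Hypothesis Q_pt : forall n h, H h -> Q n ∘ h ∘ eta_r = hpow h n ∘ eta_r.

Lemma power_map_phase n h : H h ->
  Q n ∘ h = hpow h n ∘ Q n.
Proof.
move=> Hh; apply: enough => k Hk; rewrite -!compA  Q_pt // [h ∘ _]compA.
rewrite Q_pt; last exact: (pg_comp HG).
by rewrite hpow_comp ?compA //; exact: phase_groupC.
Qed.

Lemma power_map_eta n : Q n ∘ eta_r = eta_r.
Proof.
by have := Q_pt n (pg_id HG); rewrite hpow_id !comp_idl.
Qed.

(** The matrix elements at [k], [h] are the amplitudes of [k^n h] and of its [m]-th power [k h^m],
    which agree by [amp_hpow]. *)
Lemma dag_power_map n m : (forall h, H h -> hpow h (n * m) = h) ->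
  (Q n)^† = Q m.
Proof.
move=> nm; have mn h : H h -> hpow h (m * n) = h by rewrite mulnC; exact: nm.
apply: enough => h Hh; apply: coenough => k Hk.
have Hk' := pg_inv HG Hk.
have -> : epsilon_r ∘ k ∘ (Q n)^† ∘ h ∘ eta_r = amp (hpow k n ∘ h).
  have /(congr1 (@dag _ _ _)) := Q_pt n Hk'.
  rewrite !dag_comp dag_hpow dagK /amp -/epsilon_r !compA => E.
  by rewrite E.
rewrite Q_pt //.
have Hg : H (hpow k n ∘ h) by apply: (pg_comp HG) => //; exact: hpow_mem HG Hk.
rewrite -(amp_hpow mn Hg) hpow_comp; last first.
  by apply: phase_groupC => //; exact: hpow_mem HG Hk.
by rewrite -hpowM nm // /amp -!compA.
Qed.

Lemma epsilon_r_power_map n m : (forall h, H h -> hpow h (n * m) = h) ->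
  epsilon_r ∘ Q n = epsilon_r.
Proof.
move=> nm; apply: enough => h Hh; rewrite -compA Q_pt //.
exact: amp_hpow nm Hh.
Qed.

(** After bending, one argument is the point of some [h]; multiplying by it is [h], so the claim
    becomes [power_map_phase]. *)
Lemma mu_r_power_map n : Q n ∘ mu_r = mu_r ∘ (Q n ⊗ Q n).
Proof.
apply: (@bend_inj _ _ (red F)); apply: enough => h Hh; rewrite !bend_pt.
congr ((_ ⊗ _) ∘ _); rewrite -!compA phase_mu_pt; last exact: (pg_phase HG).
rewrite power_map_phase // [(Q n ⊗ _) ∘ _]compA -tensm_comp comp_idr.
rewrite Q_pt // tens_split -compA -lunitV_nat.
rewrite !compA -(compA mu_r) phase_mu_pt //.
by apply: (pg_phase HG); exact: hpow_mem HG Hh.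
Qed.

Lemma delta_g_power_map n :
  delta_g ∘ Q n = (Q n ⊗ Q n) ∘ delta_g.
Proof.
apply: (@iter_scaleIr 1); apply: enough => h Hh.
rewrite /= -!scale_compr -!compA Q_pt //.
rewrite [LHS](HS (hpow_mem n HG Hh)) scale_compl (HS Hh) /tens_pt compA.
by rewrite -tensm_comp Q_pt.
Qed.

Lemma mu_g_power_map n m : (forall h, H h -> hpow h (n * m) = h) ->
  Q n ∘ mu_g = mu_g ∘ (Q n ⊗ Q n).
Proof.
rewrite mulnC => mn; have /(congr1 (@dag _ _ _)) := delta_g_power_map m.
by rewrite !dag_comp dag_tens !dagK (dag_power_map mn).
Qed.

Lemma delta_r_power_map n m : (forall h, H h -> hpow h (n * m) = h) ->
  delta_r ∘ Q n = (Q n ⊗ Q n) ∘ delta_r.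
Proof.
rewrite mulnC => mn; have /(congr1 (@dag _ _ _)) := mu_r_power_map m.
by rewrite !dag_comp dag_tens (dag_power_map mn).
Qed.

(** The adjoint claim is [epsilon_g ∘ Q m = epsilon_g], true because [epsilon_g] takes one value on
    all the points of [H]. *)
Lemma power_map_eta_g n m : (forall h, H h -> hpow h (n * m) = h) ->
  Q n ∘ eta_g = eta_g.
Proof.
rewrite mulnC => mn; rewrite -[LHS]dagK -[RHS]dagK; congr dag.
rewrite dag_comp -(dag_power_map mn) dagK; apply: enough => h Hh.
rewrite -compA Q_pt // !compA !epsilon_g_phase //.
exact: hpow_mem HG Hh.
Qed.

Lemma epsilon_r_faithful n : epsilon_r ∘ Q n = epsilon_r ->
  forall k, H k -> hpow k n = idm A -> k = idm A.
Proof.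
move=> E k Hk kn; apply: amp_faithful => //; congr (_ ∘ _).
by rewrite /amp -[in LHS]E -compA Q_pt // kn.
Qed.

Lemma mu_g_faithful n : Q n ∘ mu_g = mu_g ∘ (Q n ⊗ Q n) ->
  forall k, H k -> hpow k n = idm A -> k = idm A.
Proof.
move=> E k Hk kn; apply: amp_faithful => //.
have Qk : Q n ∘ k ∘ eta_r = eta_r by rewrite Q_pt // kn comp_idl.
have P1 : mu_g ∘ tens_pt eta_r eta_r = s • eta_r.
  have := HS (pg_id HG); rewrite /set_like comp_idl => <-.
  by rewrite -scale_compl compA special comp_idl.
(* On this pair [Q n ∘ mu_g] yields [amp k], while [Q n ⊗ Q n] sends both points to [eta_r] and
   yields [amp (idm A)]. *)
have := congr1 (fun f => s • (f ∘ tens_pt eta_r (k ∘ eta_r))) E.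
rewrite -!compA {2}/tens_pt [(Q n ⊗ _) ∘ _]compA -tensm_comp Qk power_map_eta.
rewrite -/(tens_pt _ _) P1 -amp1E -[eta_r ∘ amp (idm A)]scale_pt => <-.
have -> : mu_g ∘ tens_pt eta_r (k ∘ eta_r) = proj_eta ∘ k ∘ eta_r.
  rewrite /proj_eta /tens_pt -!compA lunitV_nat.
  by rewrite [(eta_r ⊗ idm A) ∘ _]compA -tens_split.
by rewrite scale_compl proj_eta_pt // [k ∘ _]compA compA Qk.
Qed.

(** * Translating the laws for [Q n] into scaled laws for [N n] *)

Hypothesis QE : forall n, s • Q n = s •^n (N n).

Lemma scale_iter_tens n :
  s •^n (s •^n (N n ⊗ N n)) = s • (s • (Q n ⊗ Q n)).
Proof.
by rewrite iter_scale_tensl iter_scale_tensr -QE scale_tensl scale_tensr.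
Qed.

(** Scaling both sides by [s •^n] trades each [N n] for [s • Q n] and leaves the factor [s •^2] on
    both sides, which cancels. *)
Lemma delta_r_int n :
  s • (delta_r ∘ N n) = s •^n ((N n ⊗ N n) ∘ delta_r)
  <-> delta_r ∘ Q n = (Q n ⊗ Q n) ∘ delta_r.
Proof.
have L : s •^n (s • (delta_r ∘ N n)) = s •^2 (delta_r ∘ Q n).
  by rewrite -scale_iterC iter_scale_compl -QE /= -scale_compl.
have R : s •^n (s •^n ((N n ⊗ N n) ∘ delta_r)) = s •^2 ((Q n ⊗ Q n) ∘ delta_r).
  by rewrite !iter_scale_compr scale_iter_tens.
split=> E; first by apply: (@iter_scaleIr 2); rewrite -L E R.
by apply: (@iter_scaleIr n); rewrite L R E.
Qed.

Lemma epsilon_r_int n :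
  s •^n (epsilon_r ∘ N n) = s • epsilon_r <-> epsilon_r ∘ Q n = epsilon_r.
Proof.
rewrite iter_scale_compl -QE -scale_compl.
by split=> [|->] // E; apply: (@iter_scaleIr 1).
Qed.

Lemma mu_g_int n :
  s • (N n ∘ mu_g) = s •^n (mu_g ∘ (N n ⊗ N n))
  <-> Q n ∘ mu_g = mu_g ∘ (Q n ⊗ Q n).
Proof.
have L : s •^n (s • (N n ∘ mu_g)) = s •^2 (Q n ∘ mu_g).
  by rewrite -scale_iterC iter_scale_compr -QE /= -scale_compr.
have R : s •^n (s •^n (mu_g ∘ (N n ⊗ N n))) = s •^2 (mu_g ∘ (Q n ⊗ Q n)).
  by rewrite !iter_scale_compl scale_iter_tens.
split=> E; first by apply: (@iter_scaleIl 2); rewrite -L E R.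
by apply: (@iter_scaleIl n); rewrite L R E.
Qed.

Lemma eta_g_int n : s •^n (N n ∘ eta_g) = s • eta_g <-> Q n ∘ eta_g = eta_g.
Proof.
rewrite iter_scale_compr -QE -scale_compr.
by split=> [|->] // E; apply: (@iter_scaleIl 1).
Qed.

End PowerMap.
End Kappa.
End GreenSetLike.

(** * Coprimality compared with the comonoid and monoid laws *)

Theorem theorem12 (C : dagger_ssmc) (A : C) (F : if_structure A)
    (GK HK : hom A A -> Prop) (d n : nat)
    (ifk : IFK F GK HK)
    (HK_finite : finite_homs HK)
    (HK_exponent : is_exponent HK d)
    (enough : enough_green_set_like F HK) :
  let s := link_of F in
  let N := internal_int F n in
  let mu_g := mu (green F) in
  let eta_g := eta (green F) in
  let delta_r := delta (red F) in
  let epsilon_r := epsilon (red F) in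
  [<-> coprime d n;
       s • (delta_r ∘ N) = s •^n ((N ⊗ N) ∘ delta_r)
         /\ s •^n (epsilon_r ∘ N) = s • epsilon_r;
       s • (N ∘ mu_g) = s •^n (mu_g ∘ (N ⊗ N))
         /\ s •^n (N ∘ eta_g) = s • eta_g].
Proof.
move=> s N mu_g eta_g delta_r epsilon_r.
have HG := ifk_red ifk; have HS := ifk_red_set_like ifk.
have [d0 Hd _] := HK_exponent.
have [kappa kP] := link_invertible HG HS enough d0 Hd.
have [Q [QE Q_pt]] := power_map_exists HG HS kP.
have faith := hpow_faithful_coprime HG HK_exponent.
have [deltaP epsP] := (delta_r_int kP QE n, epsilon_r_int kP QE n).
have [muP etaP] := (mu_g_int kP QE n, eta_g_int kP QE n).
have p12 : coprime d n -> delta_r ∘ Q n = (Q n ⊗ Q n) ∘ delta_r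
    /\ epsilon_r ∘ Q n = epsilon_r.
  case/(coprime_hpow_inv Hd) => m nm; split.
    exact: (delta_r_power_map HG HS enough kP Q_pt nm).
  exact: (epsilon_r_power_map HG HS enough kP Q_pt nm).
have p13 : coprime d n -> Q n ∘ mu_g = mu_g ∘ (Q n ⊗ Q n)
    /\ Q n ∘ eta_g = eta_g.
  case/(coprime_hpow_inv Hd) => m nm; split.
    exact: (mu_g_power_map HG HS enough kP Q_pt nm).
  exact: (power_map_eta_g HG HS enough kP Q_pt nm).
tfae.
- by move/p12 => [/deltaP ? /epsP ?].
(* The passage from comonoid to monoid laws goes through coprimality. *)
- case=> _ /epsP E; have /p13[/muP ? /etaP ?] // : coprime d n.
  by apply: faith; exact: (epsilon_r_faithful HG HS enough kP Q_pt E).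
- case=> /muP E _.
  by apply: faith; exact: (mu_g_faithful HG HS enough kP Q_pt E).
Qed.
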